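(* Let $n,d$ be positive integers, let $m\geq 2$ be an even integer, let $K$ be a totally real number field, let $(\Lambda,Q)$ be a totally positive definite $m$-ic $\mathcal{O}_K$-lattice of rank $n$, and let $\alpha\in\mathcal{O}_K$. There are only finitely many totally real extensions $L/K$ of degree $d=[L:K]$ such that $\alpha$ is represented by $(\Lambda,Q)\otimes_{\mathcal{O}_K}\mathcal{O}_L$ but, for every proper subfield $L'$ of $L$ containing $K$, $\alpha$ is not represented by $(\Lambda,Q)\otimes_{\mathcal{O}_K}\mathcal{O}_{L'}$.
   Context: All number fields are subfields of a fixed algebraic closure of $\mathbb{Q}$ containing $K$. A number field is totally real if all its complex embeddings have image in $\mathbb{R}$. $\mathcal{O}_L$ is the ring of integers of $L$. $m$-ic forms: Let $V$ be a finite-dimensional $K$-vector space. An $m$-ic form on $V$ is a map $Q:V\to K$ with $Q(av)=a^mQ(v)$ for all $a\in K$, $v\in V$ and such that the map $M_Q(v_1,\dots,v_m)=\frac{1}{m!}\sum_{I\subseteq\{1,\dots,m\}}(-1)^{m-|I|}Q\left(\sum_{i\in I}v_i\right)$ (an empty sum being $0$) is $K$-multilinear. In coordinates, $Q$ is given by a homogeneous polynomial of degree $m$. An $m$-ic $\mathcal{O}_K$-lattice $(\Lambda,Q)$ is a finitely generated $\mathcal{O}_K$-submodule $\Lambda\subseteq V$ of a finite-dimensional $K$-vector space $V$ (which may be taken to be the $K$-span of $\Lambda$), together with (the restriction of) an $m$-ic form $Q:V\to K$; it is always assumed integral, i.e. $Q(\Lambda)\subseteq\mathcal{O}_K$. Its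 rank is the $K$-dimension of its $K$-span. It represents $\alpha$ if $Q(v)=\alpha$ for some $v\in\Lambda$. It is totally positive definite if for every embedding $\sigma:K\to\mathbb{R}$ the real form $\sigma(Q)$ on $V\otimes_{K,\sigma}\mathbb{R}$ obtained by applying $\sigma$ to the coefficients of $Q$ takes strictly positive values on all nonzero vectors. Scalar extension: $(\Lambda,Q)\otimes_{\mathcal{O}_K}\mathcal{O}_L=(\Lambda\otimes_{\mathcal{O}_K}\mathcal{O}_L,Q_L)$, where $Q_L$ is the form obtained by extending $M_Q$ multilinearly; in particular $Q_L(v\otimes a)=a^mQ(v)$. *)

(* Defs.v *)
From HB Require Import structures.
From mathcomp Require Import all_boot all_order all_algebra all_field.
From mathcomp Require Import boolp classical_sets cardinality reals.
From mathcomp Require Import complex.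

Set Implicit Arguments.
Unset Strict Implicit.
Unset Printing Implicit Defensive.

Import Order.TTheory GRing.Theory Num.Theory.
Local Open Scope classical_set_scope.
Local Open Scope ring_scope.

Definition ring_of_integers (F : fieldType) : set F :=
  [set x | integralOver (intr : int -> F) x].

Definition totally_real (R : realType) (F : fieldType) : Prop :=
  forall (f : {rmorphism F -> R[i]}) (x : F), f x \is Num.real.

(* The finite linear combinations of elements of A with coefficients in C. *)
Definition combinations (F : fieldType) (V : lmodType F)
    (C : set F) (A : set V) : set V :=
  [set v | exists (r : nat) (a : 'I_r -> F) (g : 'I_r -> V),
     (forall i, C (a i) /\ A (g i)) /\ v = \sum_(i < r) a i *: g i].

Definition polarization (K : fieldType) (V : lmodType K) (m : nat)
    (Q : V -> K) (v : 'I_m -> V) : K :=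
  (m`!%:R)^-1 *
    \sum_(I : {set 'I_m}) (-1) ^+ (m - #|I|) * Q (\sum_(i in I) v i).

Definition multilinear (K : fieldType) (V : lmodType K) (m : nat)
    (M : ('I_m -> V) -> K) : Prop :=
  forall (v : 'I_m -> V) (i : 'I_m),
    scalar (fun u : V => M [eta v with i |-> u]).

Definition mic_form (K : fieldType) (V : lmodType K) (m : nat)
    (Q : V -> K) : Prop :=
  (forall (a : K) (v : V), Q (a *: v) = a ^+ m * Q v) /\
  multilinear (@polarization K V m Q).

Definition mic_lattice (K : fieldType) (V : lmodType K) (m : nat)
    (Lam : set V) (Q : V -> K) : Prop :=
  [/\ mic_form m Q,
      exists s : seq V,
        Lam = combinations (@ring_of_integers K) [set v | v \in s]
    & forall v, Lam v -> ring_of_integers (Q v)].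

Definition lattice_rank (K : fieldType) (V : vectType K)
    (Lam : set V) (n : nat) : Prop :=
  exists U : {vspace V},
    [set v | v \in U] = combinations [set: K] Lam /\ \dim U = n.

Definition represents (K : fieldType) (V : lmodType K)
    (Lam : set V) (Q : V -> K) (alpha : K) : Prop :=
  exists2 v, Lam v & Q v = alpha.

(* Extension of scalars along phi : K -> F.  The space V (x)_K F is modelled
   by F^(dim V), through the basis [vbasis {:V}] of V. *)
Section ScalarExtension.
Variables (K F : fieldType) (phi : {rmorphism K -> F}) (V : vectType K).

Notation basis := (vbasis {:V}).
Notation extV := 'rV[F]_(\dim {:V}).

(* v (x) 1 *)
Definition ext_vec (v : V) : extV := \row_i phi (coord basis i v).

(* The multilinear extension of the polarization of Q, on the diagonal;
   equivalently, the homogeneous polynomial of Q in the chosen basis with phi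
   applied to its coefficients. *)
Definition ext_form (m : nat) (Q : V -> K) (x : extV) : F :=
  \sum_(f : {ffun 'I_m -> 'I_(\dim {:V})})
     phi (polarization Q (fun i => basis`_(f i))) * \prod_(i < m) x 0 (f i).

(* The O_F-span of { v (x) 1 | v in Lam }.  A finitely generated submodule of
   V is torsion-free, hence flat over O_K, so that Lam (x)_{O_K} O_F is this
   submodule of V (x)_K F. *)
Definition ext_lattice (Lam : set V) : set extV :=
  combinations (@ring_of_integers F) (ext_vec @` Lam).

End ScalarExtension.

Definition totally_positive_definite (R : realType) (K : fieldType)
    (V : vectType K) (m : nat) (Q : V -> K) : Prop :=
  forall (sigma : {rmorphism K -> R}) (x : 'rV[R]_(\dim {:V})),
    x != 0 -> 0 < ext_form sigma m Q x.

Definition represents_over (K : fieldType) (V : vectType K) (m : nat)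
    (Lam : set V) (Q : V -> K) (alpha : K) (L : fieldExtType K) : Prop :=
  represents (ext_lattice (in_alg L) Lam) (ext_form (in_alg L) m Q) alpha%:A.

(* Main.v *)
Require Import Defs.
From HB Require Import structures.
From mathcomp Require Import all_boot all_order all_algebra all_field.
From mathcomp Require Import boolp classical_sets cardinality reals.
From mathcomp Require Import topology normedtype derive.
From mathcomp Require Import complex.

Set Implicit Arguments.
Unset Strict Implicit.
Unset Printing Implicit Defensive.

Import Order.TTheory GRing.Theory Num.Theory.
Local Open Scope classical_set_scope.
Local Open Scope ring_scope.

(** Let L be one of the extensions to be counted, and let x represent alpha in
    the lattice extended to O_L.  The theorem holds because x has canonical
    coordinates which are algebraic integers of bounded size, and because these
    coordinates generate L over K.

    Choice of the coordinates.  Let s generate the lattice, and let G be the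
    matrix whose rows are the elements of s in a basis of V.  As a finitely
    generated torsion-free O_K-module, the lattice is projective, so that v in
    the lattice can be written v = f(v) G with f linear over K and f(v)
    integral.  In matrix terms, there is F over K such that G F G = G and G F is
    integral ([integers_ginverse]).  If x = y G with y over O_L, then
    z = x F = y (G F) is integral and z G = x.  Here z depends linearly on x
    alone, with a matrix F that does not depend on L.  Projectivity comes from
    the invertibility of the ideals of O_K ([ideal_inverse]), which in turn
    follows from Kronecker's theorem: if the product of two polynomials has
    integral coefficients, then so has each product of a coefficient of one by a
    coefficient of the other ([integers_coef_mul]).

    Generation.  With L' = K(z), the identity x = z G exhibits x in the lattice
    extended to O_L', so alpha is represented over L'.  By minimality, L' = L.

    Boundedness.  An embedding of L in the complex numbers is real and restricts
    to a real embedding tau of K; it sends x to a real vector where tau(Q) takes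
    the value tau(alpha).  The form tau(Q) is homogeneous and positive definite,
    so by compactness of the sphere such vectors are bounded
    ([ext_form_bounded]), uniformly in tau because K has finitely many embeddings
    ([embeddings_uniform]).  Hence all conjugates of the coordinates of z are
    bounded independently of L ([dual_coordinates_bounded]).

    Finiteness.  Every root of the minimal polynomial of an element is its image
    by some embedding ([minpoly_conjugates]).  The minimal polynomial over K of a
    coordinate of z therefore has degree at most d and bounded integral
    coefficients ([minpoly_bounded]), of which there are finitely many by the
    same argument applied to K over the rationals ([finite_bounded_integers]).
    So the coordinates of z lie in a finite set of algebraic numbers, and L is
    determined by them ([range_generated]). *)

(** * Integral elements and Kronecker's theorem *)

Section Integers.
Variable F : fieldType.
Implicit Types (x y : F) (p q f g : {poly F}).

Lemma integers_int (c : int) : ring_of_integers (c%:~R : F).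
Proof. exact: (integral_id (intr : {rmorphism int -> F}) c). Qed.

Lemma integers_nat n : ring_of_integers (n%:R : F).
Proof. exact: (integral_nat (intr : {rmorphism int -> F})). Qed.

Lemma integers0 : ring_of_integers (0 : F).
Proof. exact: (integers_nat 0). Qed.

Lemma integers1 : ring_of_integers (1 : F).
Proof. exact: (integers_nat 1). Qed.

Lemma integersD x y :
  ring_of_integers x -> ring_of_integers y -> ring_of_integers (x + y).
Proof. exact: integral_add. Qed.

Lemma integersB x y :
  ring_of_integers x -> ring_of_integers y -> ring_of_integers (x - y).
Proof. exact: integral_sub. Qed.

Lemma integersM x y :
  ring_of_integers x -> ring_of_integers y -> ring_of_integers (x * y).
Proof. exact: integral_mul. Qed.

Lemma integers_sum (I : Type) (r : seq I) (P : pred I) (E : I -> F) :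
  (forall i, P i -> ring_of_integers (E i)) ->
  ring_of_integers (\sum_(i <- r | P i) E i).
Proof.
move=> intE; elim/big_rec: _ => [|i x Pi intx]; first exact: integers0.
exact: integersD (intE i Pi) intx.
Qed.

Lemma integers_map (E : fieldType) (phi : {rmorphism F -> E}) x :
  ring_of_integers (phi x) <-> ring_of_integers x.
Proof.
have eqp (p : {poly int}) : map_poly intr p = map_poly phi (map_poly intr p).
  by rewrite -map_poly_comp; apply: eq_map_poly => c /=; rewrite rmorph_int.
split=> -[p mon_p rt]; exists p => //.
  by move: rt; rewrite eqp fmorph_root.
by rewrite eqp fmorph_root.
Qed.

(** The powers of lead_coef p * z satisfy the monic equation obtained by
    multiplying p(z) = 0 by a power of the leading coefficient. *)
Lemma integers_lead_root p z :
  (forall i, ring_of_integers p`_i) -> root p z ->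
  ring_of_integers (lead_coef p * z).
Proof.
move=> intp rt; have [->|nz] := eqVneq p 0.
  by rewrite lead_coef0 mul0r; exact: integers0.
set c := lead_coef p.
have sz : (1 < size p)%N.
  rewrite ltnNge; apply/negP => /size1_polyC pE; move: rt nz.
  by rewrite pE rootC => /eqP->; rewrite eqxx.
pose n := (size p).-2.
have sn : size p = n.+2 by rewrite /n; case: (size p) sz => [|[]].
(* c^n p(z) = g(c z), where c is the leading coefficient and n + 1 the degree. *)
pose g : {poly F} := 'X^(n.+1) + \poly_(i < n.+1) (p`_i * c ^+ (n - i)).
have mon_g : g \is monic.
  by rewrite monicE lead_coefDl ?lead_coefXn // size_polyXn ltnS size_poly.
have rtg : root g (c * z).
  have : p.[z] * c ^+ n = 0 by rewrite (rootP rt) mul0r.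
  rewrite horner_coef sn big_ord_recr /= mulrDl mulr_suml.
  rewrite -[p`_n.+1]/(p`_(n.+2.-1)) -sn -/(lead_coef p) -/c => h.
  rewrite rootE /g hornerD hornerXn horner_poly addrC -[X in _ == X]h.
  apply/eqP; congr (_ + _).
    apply: eq_bigr => i _; rewrite exprMn.
    have -> : c ^+ n = c ^+ (n - i) * c ^+ i.
      by rewrite -exprD subnK // -ltnS.
    by rewrite -!mulrA; congr (_ * _); rewrite !mulrA mulrC !mulrA.
  by rewrite exprMn exprS -!mulrA; congr (_ * _); rewrite mulrC.
apply: (integral_root_monic mon_g rtg); apply/integral_poly => i.
rewrite coefD coefXn coef_poly; apply: integersD.
  exact: integers_nat.
case: ifP => _; last exact: integers0.
apply: integersM (intp i) _.
elim: (n - i)%N => [|k IH]; first exact: integers1.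
by rewrite exprS; apply: integersM (intp _) IH.
Qed.

(** With c the leading coefficient and k the degree of q, the product of
    c X^k by X - z is c X^(k+1) - (c z) X^k, whose coefficients are integral by
    the previous lemma; subtracting it leaves a quotient of smaller degree. *)
Lemma integers_div_root q z :
  (forall i, ring_of_integers (q * ('X - z%:P))`_i) ->
  forall i, ring_of_integers q`_i.
Proof.
have [n] := ubnP (size q); elim: n q => // n IHn q lt_q intp.
have [->|nz] := eqVneq q 0.
  by move=> i; rewrite coef0; exact: integers0.
set p := q * _ in intp.
have lc : lead_coef p = lead_coef q.
  by rewrite lead_coefM lead_coefXsubC mulr1.
have intc : ring_of_integers (lead_coef q) by rewrite -lc; apply: intp.
have intcz : ring_of_integers (lead_coef q * z).
  rewrite -lc; apply: integers_lead_root => //.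
  by rewrite rootM root_XsubC eqxx orbT.
(* Split off the leading term of q. *)
pose k := (size q).-1; pose c := lead_coef q.
have Eq : q = (q - c *: 'X^k) + c *: 'X^k by rewrite subrK.
have intq1 : forall i, ring_of_integers (q - c *: 'X^k)`_i.
  apply: IHn.
    rewrite ltnS in lt_q; apply: leq_trans lt_q.
    rewrite [X in (_ < X)%N]polySpred // ltnS; apply/leq_sizeP => j le_kj.
    rewrite coefB coefZ coefXn; have [->|ne] := eqVneq j k.
      by rewrite mulr1 subrr.
    rewrite mulr0 subr0 nth_default // polySpred // ltn_neqAle eq_sym.
    by rewrite ne.
  move=> i; rewrite mulrBl coefB; apply: integersB (intp i) _.
  have -> : (c *: 'X^k) * ('X - z%:P) = c *: 'X^(k.+1) - (c * z) *: 'X^k.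
    rewrite mulrBr -scalerAl -exprSr; congr (_ - _).
    by rewrite mulrC mul_polyC scalerA mulrC.
  rewrite coefB !coefZ !coefXn.
  by apply: integersB; apply: integersM => //;
    exact: integers_nat.
move=> i; rewrite Eq coefD; apply: integersD (intq1 i) _.
rewrite coefZ coefXn; apply: integersM => //.
exact: integers_nat.
Qed.

(** Kronecker's theorem when one factor splits, by induction on its roots.
    If the first factor is (X - z) f, moving X - z to the other side shows that
    the coefficients of f have integral products with those of (X - z) g, hence,
    dividing by X - z with [integers_div_root], with those of g.  Comparing the
    two gives the integrality of z f_i g_j, and so the claim for (X - z) f. *)
Lemma integers_coef_mul_split a (s : seq F) g :
  (forall k, ring_of_integers (a *: \prod_(z <- s) ('X - z%:P) * g)`_k) ->
  forall i j, ring_of_integers ((a *: \prod_(z <- s) ('X - z%:P))`_i * g`_j).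
Proof.
elim: s g => [|z s IHs] g.
  rewrite big_nil -scalerAl mul1r => intag i j.
  rewrite coefZ coef1 mulrAC; have:= intag j; rewrite coefZ => int1.
  apply: integersM => //.
  exact: integers_nat.
set f := a *: \prod_(z <- s) _ in IHs *; rewrite big_cons.
have -> : a *: (('X - z%:P) * \prod_(y <- s) ('X - y%:P)) = ('X - z%:P) * f.
  by rewrite /f scalerAr.
move=> intfg.
have intf i j : ring_of_integers (f`_i * g`_j).
  have int2 : forall j, ring_of_integers (f`_i *: g)`_j.
    apply: (@integers_div_root _ z) => k.
    rewrite -scalerAl coefZ; apply: IHs => l.
    by rewrite [g * _]mulrC mulrCA mulrA.
  by have:= int2 j; rewrite coefZ.
have intzf i j : ring_of_integers (z * f`_i * g`_j).
  have -> : z * f`_i * g`_j =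
     f`_i * ('X * g)`_j - f`_i * (g * ('X - z%:P))`_j.
    have -> : g * ('X - z%:P) = 'X * g - z *: g.
      by rewrite mulrC mulrBl mul_polyC.
    by rewrite coefB (coefZ z g) mulrBr opprB addrC subrK [RHS]mulrCA mulrA.
  apply: integersB.
    rewrite coefXM; case: ifP => _; last exact: intf.
    by rewrite mulr0; exact: integers0.
  apply: IHs => l.
  by rewrite [g * _]mulrC mulrCA mulrA.
move=> i j; rewrite mulrBl coefB coefXM coefCM mulrBl.
apply: integersB (intzf i j).
case: ifP => _; last exact: intf.
by rewrite mul0r; exact: integers0.
Qed.
End Integers.

(** Kronecker's theorem, the form of Gauss' lemma that holds over the algebraic
    integers. *)
Lemma integers_coef_mul (K : fieldType) (C : closedFieldType)
    (phi : {rmorphism K -> C}) (f g : {poly K}) :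
  (forall k, ring_of_integers (f * g)`_k) ->
  forall i j, ring_of_integers (f`_i * g`_j).
Proof.
move=> intfg i j; rewrite -(integers_map phi) rmorphM /= -!coef_map.
have [s Es] := closed_field_poly_normal (map_poly phi f).
rewrite Es; apply: integers_coef_mul_split => k.
by rewrite -Es -rmorphM coef_map integers_map.
Qed.

(** * Invertible ideals and projectivity of lattices *)

Lemma bezout_seq (n : nat) (a : nat -> int) :
  exists (e : int) (u : nat -> int),
    \sum_(k < n) u k * a k = e /\ forall k, (k < n)%N -> (e %| a k)%Z.
Proof.
elim: n => [|n [e [u [Eu dv]]]]; first by exists 0, (fun=> 0); rewrite big_ord0.
have [x [y Exy]] := Bezoutz e (a n).
exists (gcdz e (a n)), (fun k => if k == n then y else x * u k); split.
  rewrite big_ord_recr /= eqxx -Exy -Eu mulr_sumr; congr (_ + _).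
  by apply: eq_bigr => i _; rewrite ltn_eqF // mulrA.
move=> k; rewrite ltnS leq_eqVlt => /predU1P[->|/dv]; first exact: dvdz_gcdr.
exact/dvdz_trans/dvdz_gcdl.
Qed.

(** The constant coefficient of an equation satisfied by x is a multiple of x;
    it is nonzero once the powers of the variable have been divided out.  It
    plays the part of the norm of x. *)
Lemma integral_multiple (A : nzRingType) (E : idomainType)
    (phi : {rmorphism A -> E}) (x : E) :
  x != 0 -> integralOver phi x ->
  exists (y : E) (c : A), x * y = phi c /\ phi c != 0.
Proof.
move=> x0 [p mon_p]; have := monic_neq0 mon_p.
have : map_poly phi p != 0 by rewrite monic_neq0 ?monic_map.
elim/poly_ind: p {mon_p} => [|p c IHp] nzm _ rt; first by rewrite rmorph0 eqxx in nzm.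
move: nzm rt; rewrite rmorphD rmorphM /= map_polyX map_polyC /=.
have [->|c0] := eqVneq (phi c) 0.
  rewrite addr0 mulf_eq0 polyX_eq0 orbF => nz; rewrite rootM rootX (negPf x0) orbF.
  by apply: IHp => //; apply: contraNneq nz => ->; rewrite rmorph0.
move=> _; rewrite rootE !hornerE addr_eq0 => /eqP Ec.
by exists (- (map_poly phi p).[x]), c; rewrite mulrN mulrC Ec opprK.
Qed.

Section NumberField.
Variables (K : fieldExtType rat) (C : closedFieldType).
Variable phi : {rmorphism K -> C}.

Lemma integral_poly_rat (f : {poly K}) : integralOver (map_poly (in_alg K)) f.
Proof.
rewrite -[f]coefK poly_def; apply: big_ind => [|x y|i _].
- exact: (integral0 (map_poly (in_alg K))).
- exact: integral_add.
rewrite -mul_polyC; apply: integral_mul; last first.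
  by rewrite -(map_polyXn (in_alg K)); apply: integral_id.
have /polyOver1P[p Ep] := minPolyOver 1%AS f`_i.
exists (map_poly polyC p).
  by apply/monic_map; rewrite -(map_monic (in_alg K)) -Ep monic_minPoly.
rewrite -map_poly_comp -[root _ _]/(root _ (polyC f`_i)).
have -> : map_poly (map_poly (in_alg K) \o polyC) p = map_poly polyC (map_poly (in_alg K) p).
  by rewrite -map_poly_comp; apply: eq_map_poly => c /=; rewrite map_polyC.
by rewrite -Ep; apply: rmorph_root; apply: root_minPoly.
Qed.

Lemma integral_multiple_int (f : {poly K}) : f != 0 ->
  exists (g : {poly K}) (h : {poly int}), f * g = map_poly intr h /\ h != 0.
Proof.
move=> f0; have [g [h [Eg nz]]] := integral_multiple f0 (integral_poly_rat f).
have [q [a a0 Eh]] := rat_poly_scale h.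
exists (a%:~R *: g), q; split; last first.
  by apply: contraNneq nz => q0; rewrite Eh q0 rmorph0 scaler0 rmorph0.
rewrite -scalerAr Eg Eh /= map_polyZ /= scalerA.
rewrite -in_algE fmorphV rmorph_int mulfV ?scale1r; last first.
  by rewrite -(rmorph_int (in_alg K)) fmorph_eq0 intr_eq0.
by rewrite -map_poly_comp; apply: eq_map_poly => c; rewrite /= -in_algE rmorph_int.
Qed.

(** The fractional ideal generated by the a i is invertible: the b j generate
    its inverse.  Take a polynomial f with coefficients a i and a multiple f g
    with rational coefficients, scaled so that these are integers with a Bezout
    relation of sum 1.  Products of coefficients of f and g are then integral by
    Kronecker's theorem, and expanding the Bezout relation expresses 1 through
    them. *)
Lemma ideal_inverse (r : nat) (a : 'I_r -> K) (i0 : 'I_r) : a i0 != 0 ->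
  exists b : 'I_r -> K, \sum_i a i * b i = 1 /\
    forall i j, ring_of_integers (a i * b j).
Proof.
move=> a0; pose f := \poly_(k < r) (if insub k is Some i then a i else 0).
have fE (i : 'I_r) : f`_i = a i by rewrite coef_poly ltn_ord valK.
have nzf : f != 0.
  by apply: contraNneq a0 => f0; rewrite -fE f0 coef0.
have [g [h [Efg nzh]]] := integral_multiple_int nzf.
have [e [u [Eu dv]]] := bezout_seq (size h) (nth 0 h).
have e0 : e != 0.
  apply: contra nzh => /eqP ee; apply/eqP/polyP => k; rewrite coef0.
  have [/dv|/(nth_default 0)//] := ltnP k (size h).
  by rewrite ee dvd0z => /eqP.
have eK : (e%:~R : K) != 0.
  by rewrite -(rmorph_int (in_alg K)) fmorph_eq0 intr_eq0.
pose g' := e%:~R^-1 *: g.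
have Efg' : f * g' = e%:~R^-1 *: map_poly intr h by rewrite -scalerAr Efg.
have intg : forall i j, ring_of_integers (f`_i * g'`_j).
  apply: (integers_coef_mul phi) => k; rewrite Efg' coefZ coef_map /=.
  have [/dv/dvdzP[c ->]|/(nth_default 0)->] := ltnP k (size h); last first.
    by rewrite mulr0; exact: integers0.
  by rewrite intrM mulrCA mulVf // mulr1; exact: integers_int.
exists (fun i => \sum_(k < size h) (u k)%:~R * ('X^i * g')`_k); split.
  transitivity (\sum_(k < size h) (u k)%:~R * (f * g')`_k); last first.
    rewrite Efg'; under eq_bigr => k _.
      rewrite coefZ coef_map /= mulrCA -intrM; over.
    by rewrite -mulr_sumr -rmorph_sum /= Eu mulVf.
  under eq_bigr do rewrite mulr_sumr.
  rewrite exchange_big; apply: eq_bigr => k _ /=; symmetry.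
  have -> : f = \sum_(i < r) a i *: 'X^i.
    by rewrite /f poly_def; apply: eq_bigr => i _; rewrite valK.
  rewrite mulr_suml coef_sum mulr_sumr; apply: eq_bigr => i _.
  by rewrite -scalerAl coefZ mulrCA.
move=> i j; rewrite mulr_sumr; apply: integers_sum => k _.
rewrite mulrCA coefXnM; apply: integersM; first exact: integers_int.
case: ifP => _; first by rewrite mulr0; exact: integers0.
by rewrite -fE; apply: intg.
Qed.

Lemma integers_mulmx (E : fieldType) p q s (A : 'M[E]_(p, q)) (B : 'M[E]_(q, s)) :
  (forall i j, ring_of_integers (A i j)) -> (forall i j, ring_of_integers (B i j)) ->
  forall i j, ring_of_integers ((A *m B) i j).
Proof.
move=> intA intB i j; rewrite mxE; apply: integers_sum => k _.
exact: (integersM (intA i k) (intB k j)).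
Qed.

(** The lattice spanned by the rows of G over the integers of K is projective:
    the map y -> y G from integral row vectors onto it is split by v -> v F.
    The induction on columns is the usual one on rank: the first coordinate maps
    the lattice onto a fractional ideal, which is zero or invertible, hence
    projective. *)
Lemma integers_ginverse (r N : nat) (G : 'M[K]_(r, N)) :
  exists F : 'M[K]_(N, r), G *m F *m G = G /\
    forall i j, ring_of_integers ((G *m F) i j).
Proof.
elim: N G => [|N IHN] G.
  exists 0; split; first by apply/matrixP => i [].
  by move=> i j; rewrite mulmx0 mxE; exact: integers0.
rewrite -[N.+1]/(1 + N)%N in G *.
pose c := lsubmx G; pose G' := rsubmx G.
have EG : G = row_mx c G' by rewrite hsubmxK.
(* b inverts the ideal of the entries of c, or is 0 if c = 0; in both cases
   multiplying by P = 1 - c b clears the first column of G. *)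
have [b [Pc intcb]] : exists b : 'rV[K]_r, (1%:M - c *m b) *m c = 0 /\
    forall i j, ring_of_integers ((c *m b) i j).
  case: (pickP (fun i => c i 0 != 0)) => [i0 ci0|c0].
    have [b [Eb intb]] := @ideal_inverse r (fun i => c i 0) i0 ci0.
    exists (\row_i b i); split; last first.
      by move=> i j; rewrite mxE big_ord1 [X in _ * X]mxE; apply: intb.
    rewrite mulmxBl mul1mx -mulmxA.
    have -> : \row_i b i *m c = 1%:M.
      apply/matrixP => i j; rewrite !ord1 !mxE -Eb.
      by apply: eq_bigr => k _; rewrite mxE mulrC.
    by rewrite mulmx1 subrr.
  have -> : c = 0.
    by apply/matrixP => i j; rewrite ord1 !mxE; have /negbFE/eqP := c0 i; rewrite mxE.
  exists 0; split; first by rewrite mulmx0.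
  by move=> i j; rewrite mulmx0 mxE; exact: integers0.
pose P : 'M[K]_r := 1%:M - c *m b.
have intP i j : ring_of_integers (P i j).
  rewrite /P mxE [X in _ + X]mxE mxE.
  by apply: integersB; [apply: integers_nat | apply: intcb].
have [F' [EF' intF']] := IHN (P *m G').
(* The witness is chosen so that G F = c b + (P G' F') P. *)
pose E1 : 'M[K]_(1 + N, 1) := col_mx 1%:M 0.
pose E2 : 'M[K]_(1 + N, N) := col_mx 0 1%:M.
have GE1 : G *m E1 = c by rewrite EG mul_row_col mulmx1 mulmx0 addr0.
have GE2 : G *m E2 = G' by rewrite EG mul_row_col mulmx1 mulmx0 add0r.
exists (E1 *m b + (E2 - E1 *m b *m G') *m F' *m P).
have -> : G *m (E1 *m b + (E2 - E1 *m b *m G') *m F' *m P) =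
    c *m b + P *m G' *m F' *m P.
  rewrite mulmxDr !mulmxA GE1 (mulmxBr G) !mulmxA GE1 GE2.
  by have -> : P *m G' = G' - c *m b *m G' by rewrite /P mulmxBl mul1mx.
split; last first.
  move=> i j; rewrite mxE; apply: integersD; first exact: intcb.
  by apply: integers_mulmx; [exact: intF' | exact: intP].
have PG : P *m G = row_mx 0 (P *m G') by rewrite EG mul_mx_row Pc.
rewrite mulmxDl -(mulmxA _ P G) PG mul_mx_row mulmx0 EF' -PG.
by rewrite -mulmxDl /P addrC subrK mul1mx.
Qed.

End NumberField.

(** * Embeddings and conjugates *)

(** L is the quotient of the polynomials over E by those that vanish at theta;
    evaluation at w factors through it, because they are the multiples of q. *)
Lemma extend_root (E L C : fieldType) (incl : {rmorphism E -> L})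
    (psi : {rmorphism E -> C}) (theta : L) (q : {poly E}) (w : C) :
  (forall y, exists p, y = (map_poly incl p).[theta]) ->
  (forall p, root (map_poly incl p) theta -> q %| p) ->
  root (map_poly psi q) w ->
  exists f : {rmorphism L -> C}, (forall x, f (incl x) = psi x) /\ f theta = w.
Proof.
move=> gen minq rtw; have [P EP] := choice gen.
pose f y := (map_poly psi (P y)).[w].
have fE p : f (map_poly incl p).[theta] = (map_poly psi p).[w].
  apply/eqP; rewrite /f -subr_eq0 -hornerN -hornerD -rmorphN -rmorphD.
  set d := P _ + - p; have /minq dq : root (map_poly incl d) theta.
    by rewrite rootE rmorphB hornerD hornerN -EP subrr.
  rewrite -/(root _ w) -dvdp_XsubCl; apply: dvdp_trans (_ : map_poly psi q %| _).
    by rewrite dvdp_XsubCl.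
  by rewrite dvdp_map.
have faM : zmod_morphism f.
  move=> x y; rewrite [in LHS](EP x) [in LHS](EP y).
  by rewrite -hornerN -hornerD -rmorphN -rmorphD fE rmorphD rmorphN hornerD hornerN.
have fmM : monoid_morphism f.
  split=> [|x y].
    have {1}-> : 1 = (map_poly incl 1).[theta] by rewrite rmorph1 hornerC.
    by rewrite fE rmorph1 hornerC.
  rewrite [in LHS](EP x) [in LHS](EP y).
  by rewrite -hornerM -rmorphM fE rmorphM hornerM.
pose faMM := GRing.isZmodMorphism.Build L C f faM.
pose fmMM := GRing.isMonoidMorphism.Build L C f fmM.
pose fRM : {rmorphism L -> C} := HB.pack f faMM fmMM.
exists fRM; split=> [x|] /=.
  have -> : incl x = (map_poly incl x%:P).[theta] by rewrite map_polyC hornerC.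
  by rewrite fE map_polyC hornerC.
have {1}-> : theta = (map_poly incl 'X).[theta] by rewrite map_polyX hornerX.
by rewrite fE map_polyX hornerX.
Qed.

Section MinimalPolynomial.
Variables (F : fieldType) (L : fieldExtType F).
Hypothesis charL : [pchar L] =i pred0.

(** First embed K(a), then extend to L, which is generated by one element over
    K(a) in characteristic 0. *)
Lemma extend_embedding (C : closedFieldType) (sigma : {rmorphism F -> C})
    (a : L) (q : {poly F}) (w : C) :
  map_poly (in_alg L) q = minPoly 1 a -> root (map_poly sigma q) w ->
  exists f : {rmorphism L -> C}, (forall x, f x%:A = sigma x) /\ f a = w.
Proof.
move=> Eq rtw; pose E := <<1; a>>%AS.
pose a' : subvs_of E := vsproj E a.
have va' : vsval a' = a by rewrite vsprojK ?memv_adjoin.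
have mapval (p : {poly F}) :
    map_poly vsval (map_poly (in_alg (subvs_of E)) p) = map_poly (in_alg L) p.
  by rewrite -map_poly_comp; apply: eq_map_poly => x /=; rewrite algid1.
have mapev (p : {poly F}) : (map_poly (in_alg L) p).[a] =
    vsval (map_poly (in_alg (subvs_of E)) p).[a'].
  by rewrite -[in LHS]va' -[in LHS]mapval horner_map.
(* The embedding of K(a) sending a to w. *)
have [psi [psiE psia]] : exists psi : {rmorphism subvs_of E -> C},
    (forall x, psi (in_alg (subvs_of E) x) = sigma x) /\ psi a' = w.
  apply: (@extend_root _ _ _ (in_alg (subvs_of E)) sigma a' q) => //.
    move=> y; have /Fadjoin1_polyP[p Ep] := subvsP y.
    exists p; apply: val_inj; rewrite /= Ep; apply: mapev.
  move=> p; rewrite -(dvdp_map (in_alg L)) Eq => rt.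
  apply: minPoly_dvdp; first by apply/polyOver1P; exists p.
  by rewrite rootE mapev (rootP rt).
pose theta := separable_generator E {:L}.
have EL : {:L}%VS = <<E; theta>>%VS.
  apply: eq_adjoin_separable_generator; last exact: subvf.
  by apply/separableP => y _; apply: pcharf0_separable.
have /polyOver_subvs[r Er] := minPolyOver E theta.
have [v rtv] : exists v, root (map_poly psi r) v.
  apply/closed_rootP; rewrite size_map_poly -(size_map_poly vsval) -Er.
  by rewrite size_minPoly.
have [f [fE _]] : exists f : {rmorphism L -> C},
    (forall x, f (vsval x) = psi x) /\ f theta = v.
  apply: (@extend_root _ _ _ vsval psi theta r) => //.
    move=> y; have : y \in <<E; theta>>%VS by rewrite -EL memvf.
    by move=> /Fadjoin_polyP[p /polyOver_subvs[p' ->] ->]; exists p'.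
  move=> p rt; rewrite -(dvdp_map vsval) -Er; apply: minPoly_dvdp => //.
  by apply/polyOver_subvs; exists p.
exists f; split=> [x|]; last by rewrite -va' fE.
by rewrite -psiE -fE /= algid1.
Qed.

(** q is the minimal polynomial of a, which is irreducible, so each of its roots
    is the image of a by an embedding.  A bound on all images of a thus bounds
    the roots of q, and integrality of a makes them integral. *)
Lemma minpoly_conjugates (a : L) : exists q : {poly F},
  [/\ q \is monic, root (map_poly (in_alg L) q) a, (size q <= (\dim {:L}).+1)%N &
      forall (C : closedFieldType) (sigma : {rmorphism F -> C}),
      exists s : seq C,
      [/\ map_poly sigma q = \prod_(w <- s) ('X - w%:P), (size s <= \dim {:L})%N &
          forall w, w \in s -> exists f : {rmorphism L -> C},
            (forall x, f x%:A = sigma x) /\ f a = w]].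
Proof.
have /polyOver1P[q Eq] := minPolyOver 1%AS a.
have mon_q : q \is monic.
  by rewrite -(map_monic (in_alg L)) -Eq monic_minPoly.
have sz_q : (size q <= (\dim {:L}).+1)%N.
  rewrite -(size_map_poly (in_alg L)) -Eq size_minPoly ltnS adjoin_degreeE.
  by rewrite dimv1 divn1 dimvS ?subvf.
exists q; split=> //; first by rewrite -Eq root_minPoly.
move=> C sigma; have [s Es] := closed_field_poly_normal (map_poly sigma q).
rewrite (monicP _) ?map_monic // scale1r in Es.
exists s; split=> //.
  by rewrite -ltnS -(size_prod_XsubC s id) -Es size_map_poly.
move=> w ws; apply: (extend_embedding (esym Eq)).
by rewrite Es root_prod_XsubC.
Qed.
End MinimalPolynomial.

Lemma real_embedding (R : rcfType) (L : fieldType) (f : {rmorphism L -> R[i]}) :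
  (forall x, f x \is Num.real) ->
  exists g : {rmorphism L -> R}, forall x, f x = (g x)%:C%C.
Proof.
move=> real_f; pose g x := complex.Re (f x).
have gE x : (g x)%:C%C = f x by apply: RRe_real.
have gaM : zmod_morphism g.
  by move=> x y; apply: (@complexI R); rewrite gE !rmorphB /= !gE.
have gmM : monoid_morphism g.
  split=> [|x y]; apply: (@complexI R); rewrite gE ?rmorph1 //.
  by rewrite !rmorphM /= !gE.
pose gaMM := GRing.isZmodMorphism.Build L R g gaM.
pose gmMM := GRing.isMonoidMorphism.Build L R g gmM.
pose gRM : {rmorphism L -> R} := HB.pack g gaMM gmMM.
by exists gRM => x; rewrite /= gE.
Qed.

(** An embedding is determined by the image of a primitive element, hence by a
    root of a fixed polynomial, so there are finitely many of them up to
    pointwise equality.  Here P f B is meant to say that B is a bound valid for f. *)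
Lemma embeddings_uniform (R : realType) (K : fieldExtType rat)
    (P : {rmorphism K -> R} -> R -> Prop) :
  (forall (f g : {rmorphism K -> R}) B, f =1 g -> P f B -> P g B) ->
  (forall f B B', B <= B' -> P f B -> P f B') ->
  (forall f, exists B, P f B) ->
  exists2 B, 0 <= B & forall f, P f B.
Proof.
move=> Pext Pmono Pex.
have charK : [pchar K] =i pred0.
  by move=> p; rewrite (pchar_lalg K) pchar_num.
pose theta := separable_generator 1 {:K}.
have EK : {:K}%VS = <<1; theta>>%VS.
  apply: eq_adjoin_separable_generator; last exact: subvf.
  by apply/separableP => y _; apply: pcharf0_separable.
have fext (f g : {rmorphism K -> R}) : f theta = g theta -> f =1 g.
  move=> fg y; have : y \in <<1; theta>>%VS by rewrite -EK memvf.
  case/Fadjoin1_polyP => p ->; rewrite -!horner_map fg /=; congr _.[_].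
  rewrite -!map_poly_comp; apply: eq_map_poly => x.
  exact: (etrans (fmorph_eq_rat (f \o in_alg K) x) (esym (fmorph_eq_rat (g \o in_alg K) x))).
have bnd (w : R[i]) : exists B, forall f : {rmorphism K -> R},
    (f theta)%:C%C = w -> P f B.
  have [[f0 <-]|nof] := pselect (exists f : {rmorphism K -> R}, (f theta)%:C%C = w).
    have [B PB] := Pex f0; exists B => f /(@complexI R) Ef.
    by apply: Pext PB; apply: fext.
  by exists 0 => f Ef; case: nof; exists f.
have [B PB] := choice bnd.
have [q [mon_q rt _ _]] := minpoly_conjugates charK theta.
pose c := (ratr : {rmorphism rat -> R[i]}).
have [s Es] := closed_field_poly_normal (map_poly c q).
exists (\sum_(w <- s) `|B w|); first exact: sumr_ge0.
move=> f; have ws : (f theta)%:C%C \in s.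
  have : root (map_poly c q) (f theta)%:C%C.
    have -> : map_poly c q =
        map_poly (real_complex R \o f) (map_poly (in_alg K) q).
      rewrite -map_poly_comp; apply: eq_map_poly => x.
      exact: (esym (fmorph_eq_rat (real_complex R \o f \o in_alg K) x)).
    by rewrite -[X in root _ X]/((real_complex R \o f) theta) fmorph_root.
  by rewrite Es rootZ ?root_prod_XsubC // (monicP _) ?map_monic // oner_eq0.
apply: Pmono (PB _ f erefl).
rewrite (perm_big _ (perm_to_rem ws)) big_cons.
by apply: (le_trans (ler_norm _)); rewrite lerDl sumr_ge0.
Qed.

(** * Finiteness of integers with bounded conjugates *)

(** Each factor X - w multiplies the largest coefficient by at most 1 + B. *)
Lemma coef_prod_XsubC_le (C : numDomainType) (s : seq C) (B : C) :
  0 <= B -> (forall w, w \in s -> `|w| <= B) ->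
  forall k, `|(\prod_(w <- s) ('X - w%:P))`_k| <= (1 + B) ^+ size s.
Proof.
move=> B0; elim: s => [|w s IHs] le_sB k.
  by rewrite big_nil coef1 expr0; case: (k == 0%N); rewrite ?normr1 ?normr0.
rewrite big_cons mulrBl coefB coefXM coefCM exprS mulrDl mul1r.
apply: (le_trans (ler_normB _ _)).
have IH j : `|(\prod_(w <- s) ('X - w%:P))`_j| <= (1 + B) ^+ size s.
  by apply: IHs => v vs; apply: le_sB; rewrite inE vs orbT.
apply: lerD; first by case: ifP => _; rewrite ?normr0 // exprn_ge0 // addr_ge0.
by rewrite normrM ler_pM // le_sB // inE eqxx.
Qed.

Lemma finite_roots (F : fieldType) (E : closedFieldType)
    (psi : {rmorphism F -> E}) (T : set F) (n : nat) : finite_set T ->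
  finite_set [set z : E | exists q : {poly F},
    [/\ q \is monic, (size q <= n)%N, forall k, T q`_k & root (map_poly psi q) z]].
Proof.
case/finite_seqP => s ->.
pose poly_of (t : {ffun 'I_n -> seq_sub s}) : {poly F} :=
  \sum_(i < n) ssval (t i) *: 'X^i.
pose rts t := sval (closed_field_poly_normal (map_poly psi (poly_of t))).
apply: (@sub_finite_set _ _ (\bigcup_(t in [set: {ffun 'I_n -> seq_sub s}]) [set` rts t])).
  move=> z [q [mon_q sz_q Tq rt]].
  exists [ffun i : 'I_n => SeqSub (Tq i)] => //=.
  have Eq : poly_of [ffun i : 'I_n => SeqSub (Tq i)] = q.
    rewrite /poly_of; apply/polyP => k; rewrite coef_sum.
    under eq_bigr => i _ do rewrite coefZ coefXn ffunE /=.
    have [lt_kn|le_nk] := ltnP k n.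
      rewrite (bigD1 (Ordinal lt_kn)) //= eqxx mulr1 big1 ?addr0 // => i ne.
      by rewrite eq_sym -[k]/(val (Ordinal lt_kn)) val_eqE (negPf ne) mulr0.
    rewrite nth_default ?(leq_trans sz_q) // big1 // => i _.
    by rewrite gtn_eqF ?mulr0 // (leq_trans (ltn_ord i)).
  rewrite /rts; case: closed_field_poly_normal => r /= Er.
  move: rt; rewrite -{1}Eq Er Eq rootZ ?root_prod_XsubC //.
  by rewrite (monicP _) ?map_monic // oner_eq0.
apply: bigcup_finite => [|t _]; first exact: finite_finset.
exact: finite_seq.
Qed.

(** The inductive step of Northcott's finiteness theorem: bounds on the
    conjugates of an integer a over the base field F become bounds on finitely
    many integers of F. *)
Lemma minpoly_bounded (F : fieldType) (L : fieldExtType F)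
    (charL : [pchar L] =i pred0) (C0 : closedFieldType)
    (sigma0 : {rmorphism F -> C0}) (C : numClosedFieldType) (B : C) (a : L) :
  0 <= B -> ring_of_integers a -> (forall f : {rmorphism L -> C}, `|f a| <= B) ->
  exists q : {poly F},
  [/\ q \is monic, root (map_poly (in_alg L) q) a, (size q <= (\dim {:L}).+1)%N,
      forall k, ring_of_integers q`_k &
      forall (sigma : {rmorphism F -> C}) k,
        `|sigma q`_k| <= (1 + B) ^+ \dim {:L}].
Proof.
move=> B0 inta le_aB; have [q [mon_q rt sz_q conj]] := minpoly_conjugates charL a.
exists q; split=> // [k|sigma k].
  rewrite -(integers_map sigma0) -coef_map.
  have [s [-> _ sP]] := conj _ sigma0.
  have: forall w, w \in s -> ring_of_integers w.
    by move=> w /sP[f [_ <-]]; apply/integers_map.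
  elim: s k {sP} => [|w s IHs] k ints.
    by rewrite big_nil coef1; exact: integers_nat.
  have ints' j : ring_of_integers (\prod_(w <- s) ('X - w%:P))`_j.
    by apply: IHs => v vs; apply: ints; rewrite inE vs orbT.
  rewrite big_cons mulrBl coefB coefXM coefCM; apply: integersB.
    by case: ifP => _ //; exact: integers0.
  by apply: integersM => //; apply: ints; rewrite inE eqxx.
rewrite -coef_map; have [s [-> sz_s sP]] := conj _ sigma.
apply: le_trans (_ : _ <= (1 + B) ^+ size s) _.
  by apply: coef_prod_XsubC_le => // w /sP[f [_ <-]].
by apply: ler_weXn2l => //; rewrite lerDl.
Qed.

Lemma integers_rat (x : rat) : ring_of_integers x -> exists z : int, x = z%:~R.
Proof.
move=> intx; have : ratr x \in Aint.
  have [p mon_p rt] := (integers_map (ratr : {rmorphism rat -> algC}) x).2 intx.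
  apply: root_monic_Aint rt _ _; first exact: monic_map.
  by apply/polyOverP => i; rewrite coef_map /= intr_int.
move/(Cint_rat_Aint (Crat_rat x))/intrP => [z Ez]; exists z.
by apply: (fmorph_inj (ratr : {rmorphism rat -> algC})); rewrite /= Ez ratr_int.
Qed.

(** Northcott's theorem for a fixed number field: the minimal polynomials over
    the rationals have bounded degree and bounded integer coefficients. *)
Lemma finite_bounded_integers (R : realType) (K : fieldExtType rat)
    (iota : {rmorphism K -> algC}) (B : R) : 0 <= B ->
  finite_set [set c : K | ring_of_integers c /\
    forall f : {rmorphism K -> R[i]}, `|f c| <= B%:C%C].
Proof.
move=> B0; pose D := \dim {:K}; pose M := Num.bound ((1 + B) ^+ D).
pose T := [set x : rat | exists2 z : int, x = z%:~R & (`|z| <= M)%N].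
have finT : finite_set T.
  apply: (@sub_finite_set _ _
    ((fun u : bool * 'I_M.+1 => (-1) ^+ u.1 * (u.2 : nat)%:R) @` setT)).
    move=> _ [z -> le_zM]; exists (z < 0, inord `|z|%N) => //=.
    rewrite inordK ?ltnS // [in RHS](intEsign z) rmorphM /= rmorph_sign.
    by rewrite -pmulrn.
  by apply: finite_image; exact: finite_finset.
have finZ := finite_roots (ratr : {rmorphism rat -> algC}) D.+1 finT.
apply: (@sub_finite_set _ _ (iota @^-1` _)); last first.
  apply: finite_preimage finZ => x y _ _; exact: fmorph_inj.
have charK : [pchar K] =i pred0.
  by move=> p; rewrite (pchar_lalg K) pchar_num.
move=> c [intc le_c] /=.
have BC0 : 0 <= B%:C%C by rewrite lecR.
have [q [mon_q rt sz_q intq le_q]] :=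
  minpoly_bounded charK (ratr : {rmorphism rat -> algC}) BC0 intc le_c.
exists q; split=> // [k|]; last first.
  have -> : map_poly (ratr : {rmorphism rat -> algC}) q =
      map_poly iota (map_poly (in_alg K) q).
    rewrite -map_poly_comp; apply: eq_map_poly => x.
    by rewrite /= -(fmorph_eq_rat (iota \o in_alg K)).
  by rewrite fmorph_root.
have [z Ez] := integers_rat (intq k); exists z => //.
have := le_q (ratr : {rmorphism rat -> R[i]}) k.
rewrite Ez /= ratr_int -[1]/(1%:C%C) -rmorphD -rmorphXn /=.
rewrite -(rmorph_int (real_complex R)) normc_def /=.
rewrite expr0n addr0 sqrtr_sqr lecR => le_z.
have ge0 : 0 <= (1 + B) ^+ D by rewrite exprn_ge0 // addr_ge0.
have := le_lt_trans le_z (archi_boundP ge0).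
by rewrite -intr_norm -natr_absz ltr_nat => /ltnW.
Qed.

(** * Positive definite forms *)

Section PositiveDefinite.
Import numFieldNormedType.Exports.

Lemma ler_coord_norm (R : realType) (N : nat) (x : 'rV[R]_N) i :
  `|x 0 i| <= `|x|.
Proof.
rewrite [leRHS]/Num.norm /= mx_normrE; apply/bigmax_geP; right.
by exists (0, i).
Qed.

(** By compactness p is at least some c > 0 on the unit sphere, hence p x is at
    least c times the m-th power of the norm of x. *)
Lemma homogeneous_bounded (R : realType) (N m : nat) (p : 'rV[R]_N -> R) :
  (0 < m)%N -> continuous p -> (forall t x, p (t *: x) = t ^+ m * p x) ->
  (forall x, x != 0 -> 0 < p x) ->
  forall beta, exists B, forall x, p x = beta -> forall i, `|x 0 i| <= B.
Proof.
move=> m0 cp hom pos beta; pose A := [set x : 'rV[R]_N | `|x| = 1].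
have normA x : x != 0 -> A (`|x|^-1 *: x).
  move=> x0; rewrite /A /= normrZ normfV normr_id mulVf //.
  by rewrite normr_eq0.
have [A0|A0] := pselect (A !=set0); last first.
  exists 0 => x _ i; have [->|x0] := eqVneq x 0; first by rewrite mxE normr0.
  by case: A0; exists (`|x|^-1 *: x); apply: normA.
have cA : compact A.
  apply: bounded_closed_compact.
    exists 1; split; first exact: num_real.
    by move=> M M1 x /= ->; apply: ltW.
  rewrite (_ : A = (fun x : 'rV[R]_N => `|x|) @^-1` [set 1]) //.
  apply: closed_comp => [x _|]; first exact: norm_continuous.
  exact: closed_eq.
have [c cA1 cmin] := EVT_min_rV A0 cA (continuous_subspaceT cp).
have pc0 : 0 < p c.
  apply: pos; apply/eqP => c0; move: cA1; rewrite inE /A /= c0 normr0.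
  by move/eqP; rewrite eq_sym oner_eq0.
exists (1 + `|beta| / p c) => x px i; apply: (le_trans (ler_coord_norm _ _)).
have b0 : 0 <= `|beta| / p c by rewrite divr_ge0 // ltW.
have [le1|/ltW ge1] := leP `|x| 1; first by rewrite ler_wpDr.
have x0 : x != 0 by rewrite -normr_gt0 (lt_le_trans _ ge1).
rewrite ler_wpDl // ler_pdivlMr //.
apply: (@le_trans _ _ (`|x| ^+ m * p c)).
  apply: ler_wpM2r; first exact: ltW.
  by rewrite -[X in X <= _]expr1; apply: ler_weXn2l.
apply: (@le_trans _ _ (`|x| ^+ m * p (`|x|^-1 *: x))).
  apply: ler_wpM2l; first exact: exprn_ge0.
  by apply: cmin; rewrite inE; apply: normA.
by rewrite -hom scalerA mulfV ?normr_eq0 // scale1r px ler_norm.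
Qed.

Lemma ext_form_bounded (R : realType) (K : fieldType) (tau : {rmorphism K -> R})
    (V : vectType K) (m : nat) (Q : V -> K) :
  (0 < m)%N ->
  (forall x : 'rV[R]_(\dim {:V}), x != 0 -> 0 < ext_form tau m Q x) ->
  forall beta, exists B, forall x, ext_form tau m Q x = beta ->
    forall i, `|x 0 i| <= B.
Proof.
move=> m0 pos; apply: (homogeneous_bounded m0) => // [|t x].
  apply: continuous_big => [|f _]; first exact: add_continuous.
  have cprod : continuous (fun x : 'rV[R]_(\dim {:V}) => \prod_(i < m) x 0 (f i)).
    apply: continuous_big => [|i _]; first exact: mul_continuous.
    exact: coord_continuous.
  move=> x; apply: (continuous_comp (cprod x)).
  exact: mulrl_continuous.
rewrite /ext_form mulr_sumr; apply: eq_bigr => f _.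
rewrite mulrCA; congr (_ * _).
under eq_bigr do rewrite mxE.
by rewrite big_split prodr_const card_ord.
Qed.

End PositiveDefinite.

Lemma ext_form_map (K F E : fieldType) (phi : {rmorphism K -> F})
    (phi' : {rmorphism K -> E}) (psi : {rmorphism F -> E}) (V : vectType K)
    (m : nat) (Q : V -> K) (x : 'rV[F]_(\dim {:V})) :
  (forall a, psi (phi a) = phi' a) ->
  psi (ext_form phi m Q x) = ext_form phi' m Q (map_mx psi x).
Proof.
move=> comm; rewrite /ext_form rmorph_sum; apply: eq_bigr => f _.
rewrite rmorphM rmorph_prod comm; congr (_ * _).
by apply: eq_bigr => i _; rewrite mxE.
Qed.

(** The extended lattice is generated over the integers of F by the images of
    the generators s, the rows of G. *)
Lemma ext_latticeP (K F : fieldType) (phi : {rmorphism K -> F})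
    (V : vectType K) (s : seq V) (x : 'rV[F]_(\dim {:V})) :
  let G := \matrix_(i < size s, k < \dim {:V}) coord (vbasis {:V}) k s`_i in
  ext_lattice phi (combinations (@ring_of_integers K) [set v | v \in s]) x <->
  exists2 y : 'rV[F]_(size s),
    (forall i, ring_of_integers (y 0 i)) & x = y *m map_mx phi G.
Proof.
move=> G.
have rowG (i : 'I_(size s)) : ext_vec phi s`_i = row i (map_mx phi G).
  by apply/rowP => k; rewrite !mxE.
split=> [[r [a [g [ag ->]]]]|[y inty ->]]; last first.
  exists (size s), (fun i => y 0 i), (fun i => ext_vec phi s`_i); split.
    move=> i; split=> //; exists s`_i => //.
    exists 1%N, (fun=> 1), (fun=> s`_i); split; last by rewrite big_ord1 scale1r.
    by move=> _; split; [exact: integers1 | exact: mem_nth].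
  by rewrite mulmx_sum_row; apply: eq_bigr => i _; rewrite rowG.
pose W (x : 'rV[F]_(\dim {:V})) := exists2 y : 'rV[F]_(size s),
    (forall i, ring_of_integers (y 0 i)) & x = y *m map_mx phi G.
have Wsum t (b : 'I_t -> F) (h : 'I_t -> 'rV[F]_(\dim {:V})) :
    (forall i, ring_of_integers (b i) /\ W (h i)) -> W (\sum_i b i *: h i).
  move=> bh; apply: big_ind => [|u v [y inty ->] [y' inty' ->]|i _].
  - by exists 0; rewrite ?mul0mx // => i; rewrite mxE; exact: integers0.
  - exists (y + y'); rewrite ?mulmxDl // => i; rewrite mxE.
    by apply: integersD; [exact: inty | exact: inty'].
  have [intb [y inty ->]] := bh i.
  exists (b i *: y); rewrite ?scalemxAl // => k; rewrite mxE.
  by apply: integersM; [exact: intb | exact: inty].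
apply: (Wsum r a g) => i; have [inta [u [t [b [h [bh ->]]]] <-]] := ag i; split=> //.
have -> : ext_vec phi (\sum_(l < t) b l *: h l) =
    \sum_(l < t) phi (b l) *: ext_vec phi (h l).
  apply/rowP => k; rewrite mxE summxE linear_sum rmorph_sum.
  by apply: eq_bigr => l _; rewrite linearZ rmorphM !mxE.
apply: (Wsum t) => l; have [intb hs] := bh l; split; first exact/integers_map.
pose l' : 'I_(size s) := Ordinal (etrans (index_mem _ _) hs).
have -> : h l = s`_l' by rewrite nth_index.
exists (delta_mx 0 l'); last by rewrite rowG rowE.
by move=> k; rewrite mxE; exact: integers_nat.
Qed.

(** For use with the matrix F that computes the canonical coordinates of a
    vector x of the lattice. *)
Lemma dual_coordinates_bounded (R : realType) (K : fieldExtType rat)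
    (V : vectType K) (m r : nat) (Q : V -> K) (F : 'M[K]_(\dim {:V}, r)) (alpha : K) :
  (0 < m)%N -> totally_positive_definite R m Q ->
  exists2 B : R, 0 <= B & forall (tau : {rmorphism K -> R}) x,
    ext_form tau m Q x = tau alpha ->
    forall i, `|(x *m map_mx tau F) 0 i| <= B.
Proof.
move=> m0 pos; apply: embeddings_uniform => [f g B fg PB x|f B B' leB PB x Ex i|tau].
- move=> Ex i; have -> : map_mx g F = map_mx f F.
    by apply/matrixP => k l; rewrite !mxE fg.
  apply: PB; rewrite fg -Ex; apply: eq_bigr => h _.
  by rewrite fg.
- exact: le_trans (PB x Ex i) leB.
have [B PB] := ext_form_bounded m0 (pos tau) (tau alpha).
exists (\sum_i \sum_k B * `|tau (F k i)|) => x Ex i.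
rewrite mxE (bigD1 i) //=; apply: (le_trans (ler_norm_sum _ _ _)).
rewrite ler_wpDr //.
  apply: sumr_ge0 => l _; apply: sumr_ge0 => k _.
  by rewrite mulr_ge0 // (le_trans _ (PB x Ex k)).
apply: ler_sum => k _; rewrite !mxE normrM.
by apply: ler_wpM2r => //; apply: PB.
Qed.

(** * Minimal representations *)

(** The subring generated by the base field and t; when t is algebraic, this is
    the subfield that it generates. *)
Definition generated (K : fieldType) (E : fieldType) (iota : K -> E) (I : Type)
    (t : I -> E) : set E :=
  [set z | forall T : set E, (forall a, T (iota a)) -> (forall i, T (t i)) ->
     (forall x y, T x -> T y -> T (x + y)) ->
     (forall x y, T x -> T y -> T (x * y)) -> T z].

(** The subset of E that records L depends only on the
    images of a finite generating family, which is what makes counting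
    possible. *)
Lemma range_generated (K E : fieldType) (L : fieldExtType K)
    (iota : K -> E) (j : {rmorphism L -> E}) (r : nat) (z : 'I_r -> L) :
  (forall a, j a%:A = iota a) ->
  {:L}%VS = <<1 & [seq z i | i <- enum 'I_r]>>%VS ->
  range j = generated iota (fun i => j (z i)).
Proof.
move=> jK EL; apply/seteqP; split=> [_ [y _ <-] T TK Tz TD TM | w]; last first.
  apply; first by move=> a; exists a%:A.
  - by move=> i; exists (z i).
  - by move=> _ _ [x _ <-] [y _ <-]; exists (x + y); rewrite ?rmorphD.
  by move=> _ _ [x _ <-] [y _ <-]; exists (x * y); rewrite ?rmorphM.
have : y \in <<1 & [seq z i | i <- enum 'I_r]>>%VS by rewrite -EL memvf.
have : forall x, x \in [seq z i | i <- enum 'I_r] -> T (j x).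
  by move=> _ /mapP[i _ ->].
elim/last_ind: [seq _ | _ <- _] y => [|rs x IHrs] y Trs.
  by rewrite Fadjoin_nil => /vlineP[a ->]; rewrite jK.
rewrite adjoin_rcons => /(@Fadjoin_polyP _ _ <<1 & rs>>%AS)[p Kp ->].
have Tx : T (j x) by apply: Trs; rewrite mem_rcons inE eqxx.
have Tp i : T (j p`_i).
  apply: IHrs; last exact: (polyOverP Kp).
  by move=> v vs; apply: Trs; rewrite mem_rcons inE vs orbT.
have T0 : T 0 by rewrite -(rmorph0 j) -(scale0r 1) jK.
elim/poly_ind: p {Kp} Tp => [|p c IHp] Tp; first by rewrite horner0 rmorph0.
rewrite hornerMXaddC rmorphD rmorphM; apply: TD; last first.
  by have := Tp 0%N; rewrite coefD coefMX coefC add0r.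
apply: TM => //; apply: IHp => i.
by have := Tp i.+1; rewrite coefD coefMX coefC addr0.
Qed.

(* [algC] is the fixed algebraic closure of the rationals, containing K through
   [iota]; an extension L/K inside it is recorded by its underlying subset. *)
Theorem theorem5p3 (R : realType) (n d m : nat)
    (hn : (0 < n)%N) (hd : (0 < d)%N) (hm : (2 <= m)%N) (hm_even : ~~ odd m)
    (K : fieldExtType rat) (iota : {rmorphism K -> algC})
    (hK : totally_real R K)
    (V : vectType K) (Lam : set V) (Q : V -> K)
    (hLam : mic_lattice m Lam Q) (hrank : lattice_rank Lam n)
    (hpos : totally_positive_definite R m Q)
    (alpha : K) (halpha : ring_of_integers alpha) :
  finite_set [set S : set algC |
    exists (L : fieldExtType K) (j : {rmorphism L -> algC}),
      [/\ (forall a : K, j a%:A = iota a) /\ S = range j,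
          totally_real R L,
          \dim {:L} = d,
          represents_over m Lam Q alpha L
        & forall L' : {subfield L}, (L' != {:L} :> {vspace L})%VS ->
            ~ represents_over m Lam Q alpha (subvs_of L')]].
Proof.
have [_ [s LamE] _] := hLam.
pose G := \matrix_(i < size s, k < \dim {:V}) coord (vbasis {:V}) k s`_i.
have [F [GFG intGF]] := integers_ginverse iota G.
(* B bounds the conjugates of the coordinates, hence (1 + B)^d bounds those of
   the coefficients of their minimal polynomials. *)
have [B B0 le_B] := dual_coordinates_bounded F alpha (ltnW hm) hpos.
have B0' : 0 <= (1 + B) ^+ d by rewrite exprn_ge0 // addr_ge0.
have finT := finite_bounded_integers iota B0'.
have /finite_seqP[zs Ezs] := finite_roots iota d.+1 finT.
(* One candidate field for each family of elements of the finite set zs. *)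
pose Sof (t : {ffun 'I_(size s) -> seq_sub zs}) : set algC :=
  generated iota (fun i => ssval (t i)).
apply: (@sub_finite_set _ _ (Sof @` setT)); last first.
  by apply: finite_image; exact: finite_finset.
move=> S [L [j [[jK ->] real_L dimL [x lat_x form_x] minL]]].
rewrite LamE in lat_x; have [y inty Ex] := (ext_latticeP (in_alg L) s x).1 lat_x.
rewrite -/G in Ex; pose z := x *m map_mx (in_alg L) F.
have intz i : ring_of_integers (z 0 i).
  rewrite /z Ex -mulmxA -map_mxM; apply: integers_mulmx => k l.
    by rewrite ord1; apply: inty.
  by rewrite mxE; apply/integers_map; apply: intGF.
have zG : z *m map_mx (in_alg L) G = x.
  by rewrite /z Ex -!mulmxA -!map_mxM mulmxA GFG.
pose L' := <<1 & [seq z 0 i | i <- enum 'I_(size s)]>>%AS.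
have zL' i : z 0 i \in L'.
  by apply: seqv_sub_adjoin; apply: map_f; rewrite mem_enum.
(* The same coordinates represent alpha over L', so minimality applies. *)
have EL : {:L}%VS = L'.
  apply/eqP/negPn/negP; rewrite eq_sym => /(minL L'); apply.
  pose z' : 'rV[subvs_of L']_(size s) := \row_i vsproj L' (z 0 i).
  have z'E : map_mx vsval z' = z.
    by apply/rowP => i; rewrite mxE [z' 0 i]mxE vsprojK ?zL'.
  exists (z' *m map_mx (in_alg (subvs_of L')) G).
    rewrite LamE; apply/ext_latticeP; exists z' => // i.
    by apply/(integers_map vsval); rewrite /= mxE vsprojK ?zL' //; apply: intz.
  apply: val_inj => /=.
  rewrite (@ext_form_map _ _ _ _ (in_alg L)); last first.
    by move=> a /=; rewrite algid1.
  rewrite map_mxM z'E -map_mx_comp /= algid1 -form_x -zG; congr (ext_form _ _ _ (_ *m _)).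
  by apply/matrixP => i k; rewrite !mxE /= algid1.
have charL : [pchar L] =i pred0.
  by move=> p; rewrite (pchar_lalg L) (pchar_lalg K) pchar_num.
have zZ i : j (z 0 i) \in zs.
  have le_f (f : {rmorphism L -> R[i]}) : `|f (z 0 i)| <= B%:C%C.
    have [g gE] := real_embedding (real_L f).
    pose tau : {rmorphism K -> R} := g \o in_alg L.
    rewrite gE normc_def /= expr0n addr0 sqrtr_sqr lecR.
    have -> : g (z 0 i) = (map_mx g x *m map_mx tau F) 0 i.
      have -> : map_mx tau F = map_mx g (map_mx (in_alg L) F).
        by apply/matrixP => k l; rewrite !mxE.
      by rewrite -map_mxM [RHS]mxE.
    apply: le_B; rewrite -(@ext_form_map _ _ _ (in_alg L) _ g) //.
    by rewrite form_x.
  have BC0 : 0 <= B%:C%C by rewrite lecR.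
  have [q [mon_q rt sz_q intq le_q]] := minpoly_bounded charL iota BC0 (intz i) le_f.
  have : [set` zs] (j (z 0 i)); last by [].
  rewrite -Ezs; exists q; split=> // [|k|].
  - by rewrite -dimL.
  - split=> // f; have := le_q f k.
    by rewrite dimL -[1]/(1%:C%C) -rmorphD -rmorphXn.
  have -> : map_poly iota q = map_poly j (map_poly (in_alg L) q).
    by rewrite -map_poly_comp; apply: eq_map_poly => a; rewrite /= jK.
  by rewrite fmorph_root.
exists [ffun i => SeqSub (zZ i)] => //.
rewrite (range_generated jK EL) /Sof; congr (generated _ _).
by apply: funext => i; rewrite ffunE.
Qed.
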